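(* Let $k$ be a field and let $x$ be an indeterminate over $k$. Then the following hold: (1) If $R$ is a maximal subring of $k(x)$ which contains $k$ and is a field, then $R\cong k(x)$. (2) $k$ is algebraically closed if and only if every maximal subring of $k(x)$ which contains $k$ is $k$-isomorphic to $k(x)$ or to $k[x]_{(x)}$.
   Context: All rings are commutative with $1\neq 0$; subrings and homomorphisms are unital. A proper subring $S$ of a ring $R$ is a maximal subring of $R$ if it is maximal with respect to inclusion among the proper subrings of $R$. Two rings containing the field $k$ as a subring are $k$-isomorphic if there is a ring isomorphism between them which restricts to the identity on $k$. $k[x]_{(x)}$ is the localization of $k[x]$ at the prime ideal $(x)$. *)

(* Defs.v *)
From HB Require Import structures.
From mathcomp Require Import all_boot all_order all_algebra.
From mathcomp Require Import ring_quotient boolp.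

Set Implicit Arguments.
Unset Strict Implicit.
Unset Printing Implicit Defensive.
Import GRing.Theory.
Local Open Scope ring_scope.

(* Subrings of A are bundled boolean predicates.  This is no restriction to
   decidable subsets: the axioms of boolp turn any Prop-valued predicate into a
   boolean one. *)
Section SubringOf.
Variables (A : comNzRingType) (S : subringClosed A).

Record subring_of : Type :=
  Subring { subring_val : A; subring_valP : subring_val \in S }.

HB.instance Definition _ := [isSub for subring_val].
HB.instance Definition _ := [Choice of subring_of by <:].
HB.instance Definition _ :=
  [SubChoice_isSubComNzRing of subring_of by <:].
End SubringOf.

Definition proper_subring (A : comNzRingType) (S : subringClosed A) : Prop :=
  exists x : A, x \notin S.

Definition maximal_subring (A : comNzRingType) (S : subringClosed A) : Prop :=
  proper_subring S /\
  forall T : subringClosed A,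
    proper_subring T -> {subset S <= T} -> {subset T <= S}.

Definition is_field (A : comNzRingType) : Prop :=
  forall a : A, a != 0 -> exists b : A, a * b = 1.

Definition ring_isomorphic (A B : comNzRingType) : Prop :=
  exists f : {rmorphism A -> B}, bijective f.

(* iA and iB are the inclusions of k in A and B. *)
Definition k_isomorphic (k : fieldType) (A B : comNzRingType)
    (iA : k -> A) (iB : k -> B) : Prop :=
  exists f : {rmorphism A -> B}, bijective f /\ forall c : k, f (iA c) = iB c.

Local Notation "x %:F" := (@FracField.tofrac _ x).

Definition ratfun (k : fieldType) : fieldType := {fraction {poly k}}.

Definition ratfun_const (k : fieldType) (c : k) : ratfun k := (c%:P)%:F.

Definition contains_const (k : fieldType) (S : subringClosed (ratfun k)) :
    Prop :=
  forall c : k, ratfun_const c \in S.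

Definition subring_const (k : fieldType) (S : subringClosed (ratfun k))
    (kS : contains_const S) (c : k) : subring_of S :=
  Subring (kS c).

(* The localization of the domain D at the prime ideal P, realized inside the
   fraction field of D. *)
Definition localization (D : idomainType) (P : prime_idealr D) :
    {pred {fraction D}} :=
  fun z => `[< exists a s : D, s \notin P /\ z = a%:F / s%:F >].

Section Localization.
Variables (D : idomainType) (P : prime_idealr D).

Let nz (s : D) : s \notin P -> s%:F != 0 :> {fraction D}.
Proof. by apply: contraNneq => /eqP; rewrite tofrac_eq0 => /eqP ->; exact: rpred0. Qed.

Let nP1 : (1 : D) \notin P.
Proof. by rewrite idealr1. Qed.

Lemma localizationP (z : {fraction D}) :
  reflect (exists a s : D, s \notin P /\ z = a%:F / s%:F) (z \in localization P).
Proof. exact: asboolP. Qed.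

Lemma localization_tofrac (a : D) : a%:F \in localization P.
Proof. by apply/localizationP; exists a, 1; rewrite tofrac1 divr1. Qed.

Fact localization_subring_closed : subring_closed (localization P).
Proof.
split=> [|_ _ /localizationP[a [s [Ps ->]]] /localizationP[b [t [Pt ->]]]
         |_ _ /localizationP[a [s [Ps ->]]] /localizationP[b [t [Pt ->]]]].
- by rewrite -tofrac1 localization_tofrac.
- apply/localizationP; exists (a * t - b * s), (s * t).
  rewrite prime_idealrM negb_or Ps Pt; split=> //.
  by rewrite tofracB !tofracM -mulNr addf_div ?nz // mulNr.
- apply/localizationP; exists (a * b), (s * t).
  rewrite prime_idealrM negb_or Ps Pt; split=> //.
  by rewrite !tofracM mulf_div.
Qed.

HB.instance Definition _ :=
  GRing.isSubringClosed.Build {fraction D} (localization P)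
    localization_subring_closed.
End Localization.

Definition idealX (k : fieldType) : {pred {poly k}} :=
  fun p => 'X %| p.

Section IdealX.
Variable k : fieldType.

Fact idealX_closed : idealr_closed (@idealX k).
Proof.
split; rewrite ?/idealX -?topredE /=.
- by rewrite dvdp0.
- by rewrite dvdp1 size_polyX.
- by move=> a p q Xp Xq; apply: dvdp_add => //; apply: dvdp_mull.
Qed.

Fact idealX_prime : prime_idealr_closed (@idealX k).
Proof.
move=> p q; rewrite /idealX -!topredE /= -['X]subr0 -polyC0 !dvdp_XsubCl.
by rewrite rootM.
Qed.

HB.instance Definition _ := isIdealr.Build {poly k} (@idealX k) idealX_closed.
HB.instance Definition _ :=
  isPrimeIdealrClosed.Build {poly k} (@idealX k) idealX_prime.
End IdealX.

Definition local_X (k : fieldType) : subringClosed (ratfun k) :=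
  localization (@idealX k).

Lemma local_X_const (k : fieldType) : contains_const (local_X k).
Proof. by move=> c; exact: localization_tofrac. Qed.

(* Main.v *)
Require Import Defs.
From HB Require Import structures.
From mathcomp Require Import all_boot all_order all_algebra.
From mathcomp Require Import generic_quotient ring_quotient polyXY boolp zify ring.

(* A maximal subring R of k(x) that contains k is either a field or, because it
   is integrally closed by maximality, a valuation ring.  In the first case
   R = k(y) by Lüroth's theorem: y is a nonconstant coefficient of the minimal
   polynomial F of x over R, and writing y = f/g in lowest terms, Gauss's lemma
   in k[x][T] shows that f(T) - y g(T) has the degree of F.  In the second case,
   x or 1/x lies in R, and if k is algebraically closed some t = x - c or
   t = 1/x - c is a non-unit of R, so R contains k[t] localized at (t), which is
   maximal.  Conversely, for p irreducible k[x] localized at (p) is maximal and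
   not a field; if it is k-isomorphic to k[x] localized at (x), its residue field
   is k and p has a root. *)

Set Implicit Arguments.
Unset Strict Implicit.
Unset Printing Implicit Defensive.
Import GRing.Theory.
Local Open Scope ring_scope.
Local Open Scope quotient_scope.
Local Notation "x %:F" := (@FracField.tofrac _ x).

(** * Gauss's lemma *)

Lemma irreducible_factor (F : fieldType) (p : {poly F}) :
  (1 < size p)%N -> exists2 q, irreducible_poly q & q %| p.
Proof.
have [n] := ubnP (size p); elim: n p => // n IHn p /ltnSE le_pn p_gt1.
have p_neq0 : p != 0 by rewrite -size_poly_gt0 ltnW.
have [irr_p|red_p] := pselect (irreducible_poly p); first by exists p.
have [q [q_neq1 dvd_qp /negP neq_qp]] :
    exists q : {poly F}, [/\ size q != 1%N, q %| p & ~ q %= p].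
  apply: contrapT => noq; apply: red_p; split=> // q q_neq1 dvd_qp.
  by apply: contrapT => neq_qp; apply: noq; exists q.
have q_gt1 : (1 < size q)%N.
  by rewrite ltn_neqAle eq_sym q_neq1 size_poly_gt0 (dvdpN0 dvd_qp).
have [|//|r irr_r dvd_rq] := IHn q; last by exists r; rewrite ?(dvdp_trans dvd_rq).
by rewrite (leq_trans _ le_pn)// ltn_neqAle dvdp_leq// dvdp_size_eqp// neq_qp.
Qed.

Lemma irredp_dvd1 (F : fieldType) (p : {poly F}) :
  irreducible_poly p -> (p %| 1) = false.
Proof. by move=> irr_p; rewrite dvdp1 gtn_eqF ?irr_p. Qed.

Lemma irredp_dvd_coprime (F : fieldType) (p f g : {poly F}) :
  irreducible_poly p -> coprimep f g -> p %| f -> p %| g -> False.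
Proof.
move=> irr_p; rewrite -gcdp_eqp1 => /eqp_dvdr eq_p dvd_pf dvd_pg.
by move: (eq_p p); rewrite dvdp_gcd dvd_pf dvd_pg irredp_dvd1.
Qed.

Lemma irredp_coprimep (F : fieldType) (p q : {poly F}) :
  irreducible_poly p -> ~~ (p %| q) -> coprimep p q.
Proof.
move=> irr_p; rewrite -[coprimep p q]negbK; apply: contra => ncop.
have: gcdp p q %= p by rewrite irr_p // dvdp_gcdl.
by move=> /eqp_dvdl <-; rewrite dvdp_gcdr.
Qed.

Lemma irredp_dvdM (F : fieldType) (p a b : {poly F}) :
  irreducible_poly p -> (p %| a * b) = (p %| a) || (p %| b).
Proof.
move=> irr_p; have [dvd_pa|ndvd_pa] := boolP (p %| a); first exact: dvdp_mulr.
by rewrite Gauss_dvdpr // irredp_coprimep.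
Qed.

(** Take the least i and j with P_i and Q_j not divisible by h. In coefficient i + j of the product,
    every other term P_l Q_(i+j-l) has l < i or i + j - l < j, so this coefficient is congruent to
    P_i Q_j modulo h. *)
Lemma gauss_prime (F : fieldType) (h : {poly F}) (P Q : {poly {poly F}}) :
  irreducible_poly h -> (forall i, h %| (P * Q)`_i) ->
  (forall i, h %| P`_i) \/ (forall i, h %| Q`_i).
Proof.
move=> irr_h hPQ; apply: contrapT => /not_orP[/existsNP exP /existsNP exQ].
have {}exP : exists i, ~~ (h %| P`_i) by have [i /negP] := exP; exists i.
have {}exQ : exists i, ~~ (h %| Q`_i) by have [i /negP] := exQ; exists i.
case: (ex_minnP exP) => i hPi min_i; case: (ex_minnP exQ) => j hQj min_j.
have lt_iij : (i < (i + j).+1)%N by rewrite ltnS leq_addr.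
have := hPQ (i + j)%N; rewrite coefM (bigD1 (Ordinal lt_iij)) //= addKn.
rewrite dvdp_addl ?irredp_dvdM ?negb_or ?(negPf hPi) ?(negPf hQj) //.
apply: (big_ind (fun q => h %| q)); [exact: dvdp0|exact: dvdp_add|].
move=> l neq_li; have [lt_li|le_il] := ltnP l i.
  by apply: dvdp_mulr; apply: contraLR lt_li => /min_i; rewrite -leqNgt.
have lt_il : (i < l)%N by rewrite ltn_neqAle le_il andbT eq_sym.
apply: dvdp_mull; apply: contraTT lt_il => /min_j.
by have := ltn_ord l; lia.
Qed.

Lemma polyC_factor (F : fieldType) (h : {poly F}) (P : {poly {poly F}}) :
  (forall i, h %| P`_i) -> exists P', P = h%:P * P'.
Proof.
move=> hP; exists (\poly_(i < size P) (P`_i %/ h)); apply/polyP => i.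
rewrite coefCM coef_poly; case: ltnP => [_|le_Pi]; first by rewrite mulrC divpK.
by rewrite mulr0 nth_default.
Qed.

(** Trivial content, tested on irreducible factors so that no gcd of coefficients has to be
    formed. *)
Definition primitive_poly (F : fieldType) (P : {poly {poly F}}) :=
  forall h, irreducible_poly h -> exists i, ~~ (h %| P`_i).

(** An irreducible factor of d divides P Q, hence Q because P is primitive; it can be cancelled, and
    the degree of d drops. *)
Lemma gauss_dvd (F : fieldType) (d : {poly F}) (P D Q : {poly {poly F}}) :
  primitive_poly P -> d != 0 -> d%:P * D = P * Q -> exists Q', D = P * Q'.
Proof.
move=> primP; have [n] := ubnP (size d); elim: n d Q => // n IHn d Q.
move=> /ltnSE le_dn d_neq0 eq_dD.
have [d_gt1|d_le1] := ltnP 1 (size d); last first.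
  have [c c_neq0 d_c] : exists2 c, c != 0 & d = c%:P.
    by apply/size_poly1P; rewrite eqn_leq d_le1 size_poly_gt0.
  exists (c^-1%:P%:P * Q); rewrite mulrCA -eq_dD d_c mulrA -!polyCM.
  by rewrite mulVf // mul1r.
have [h irr_h dvd_hd] := irreducible_factor d_gt1.
have h_neq0 : h != 0 by rewrite irredp_neq0.
have hPQ i : h %| (P * Q)`_i by rewrite -eq_dD coefCM dvdp_mulr.
case: (gauss_prime irr_h hPQ) => [hP|/polyC_factor[Q' def_Q]].
  by have [i] := primP h irr_h; rewrite hP.
have def_d : d = (d %/ h) * h by rewrite divpK.
have dh_neq0 : d %/ h != 0.
  by apply: contra_neq d_neq0; rewrite {2}def_d => ->; rewrite mul0r.
apply: (IHn (d %/ h) Q') => //.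
  by rewrite (leq_trans _ le_dn) // size_divp // ltn_subrL size_poly_gt0 d_neq0
     -subn1 subn_gt0 irr_h.
apply: (mulfI (_ : h%:P != 0)); first by rewrite polyC_eq0.
by rewrite mulrA -polyCM [h * _]mulrC -def_d eq_dD def_Q mulrCA.
Qed.

(** * Fraction fields and denominators *)

Lemma fracP (D : idomainType) (z : {fraction D}) :
  exists a b : D, b != 0 /\ z = a%:F / b%:F.
Proof.
elim/quotW: z => r; exists (\n_r), (\d_r); split; first exact: denom_ratioP.
apply: (canRL (mulfK _)); first by rewrite tofrac_eq0 denom_ratioP.
rewrite -[LHS]/(FracField.mul _ _) !piE; apply/eqmodP.
rewrite /= FracField.equivfE /FracField.mulf.
rewrite !numden_Ratio ?mulf_neq0 ?oner_eq0 ?denom_ratioP //.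
by rewrite mulr1 mulr1 mulrC.
Qed.

(* Abstracting from [{fraction D}] keeps conversion from unfolding its
   construction as a quotient. *)
Definition fraction_field (D : idomainType) (K : fieldType)
    (iota : {rmorphism D -> K}) : Prop :=
  injective iota /\ forall z, exists a b : D, b != 0 /\ z = iota a / iota b.

Section FractionField.
Variables (D : idomainType) (K : fieldType) (iota : {rmorphism D -> K}).
Hypothesis iotaK : fraction_field iota.

Lemma frac_eq0 (a : D) : (iota a == 0) = (a == 0).
Proof. by rewrite -(rmorph0 iota) (inj_eq iotaK.1). Qed.

Lemma clear_denominators (p : {poly K}) :
  exists (d : D) (P : {poly D}), d != 0 /\ iota d *: p = map_poly iota P.
Proof.
elim/poly_ind: p => [|p z [d [P [d_neq0 def_P]]]].
  by exists 1, 0; rewrite oner_neq0 scaler0 rmorph0.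
have [a [b [b_neq0 def_z]]] := iotaK.2 z.
exists (d * b), (b *: P * 'X + (d * a)%:P); split; first by rewrite mulf_neq0.
rewrite rmorphM rmorphD rmorphM /= map_polyX map_polyC /= map_polyZ /= -def_P.
rewrite scalerDr scalerA [iota d * _]mulrC -scalerAl; congr (_ + _).
by rewrite -mul_polyC -polyCM def_z mulrC mulrA mulrAC mulfK ?frac_eq0 ?rmorphM.
Qed.
End FractionField.

(** * Lüroth's theorem *)

Lemma min_witness (P : nat -> Prop) :
  (exists n, P n) -> exists2 n, P n & forall m, P m -> (n <= m)%N.
Proof.
move=> exP; have {}exP : exists n, `[< P n >] by case: exP => n /asboolP; exists n.
by case: (ex_minnP exP) => n /asboolP Pn min_n; exists n => // m /asboolP/min_n.
Qed.

(** Reduction modulo q commutes with extension of scalars, so the remainders of f and g have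
    coefficients in k related by the factor y. As y is not constant, both remainders vanish. *)
Lemma dvdp_const_pencil (k K : fieldType) (cst : {rmorphism k -> K}) (y : K)
    (q f g : {poly k}) :
  (forall c, y != cst c) ->
  map_poly cst q %|
    map_poly cst f - y *: map_poly cst g ->
  q %| f /\ q %| g.
Proof.
move=> y_nconst; rewrite /dvdp modpD modpN modpZl -!map_modp subr_eq0 => /eqP eq_fg.
have eq_coef i : cst (f %% q)`_i = y * cst (g %% q)`_i.
  by rewrite -!coef_map eq_fg coefZ.
have g0 : g %% q = 0.
  apply/polyP => i; rewrite coef0; apply: contrapT => /eqP gi_neq0.
  have /eqP[] := y_nconst ((f %% q)`_i / (g %% q)`_i).
  by rewrite fmorph_div /= eq_coef mulfK // fmorph_eq0.
split; last by rewrite g0.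
apply/eqP/polyP => i; apply: (fmorph_inj cst).
by rewrite /= eq_coef g0 !coef0 !rmorph0 mulr0.
Qed.

Section RationalFunctions.
Variables (k K : fieldType) (iota : {rmorphism {poly k} -> K}).
Hypothesis iotaK : fraction_field iota.

Let cst : {rmorphism k -> K} := iota \o polyC.

Lemma map_cst (p : {poly k}) : map_poly cst p = map_poly iota (map_poly polyC p).
Proof. by rewrite -map_poly_comp. Qed.

Lemma horner_cst (p : {poly k}) : (map_poly cst p).[iota 'X] = iota p.
Proof. by rewrite map_cst horner_map /= -[in RHS](comp_polyXr p). Qed.

(** Among the multiples of F with coefficients in k[x], one of least degree in x is primitive:
    dividing out a common irreducible factor of its coefficients would lower that degree. *)
Lemma primitive_multiple (F : {poly K}) : F != 0 ->
  exists c P, [/\ c != 0, c *: F = map_poly iota P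
                & primitive_poly P].
Proof.
move=> F_neq0; have [d [P0 [d_neq0 def_P0]]] := clear_denominators iotaK F.
pose good n := exists c P, [/\ c != 0, c *: F = map_poly iota P
                & sizeY P = n].
have [|n [c [P [c_neq0 def_P sP]]] min_n] := @min_witness good.
  by exists (sizeY P0), (iota d), P0; rewrite (frac_eq0 iotaK).
exists c, P; split=> // h irr_h; apply: contrapT => /forallNP hP.
have [|P' def_P'] := @polyC_factor _ h P.
  by move=> i; apply: contrapT => /negP/hP.
have h_neq0 : h != 0 by rewrite irredp_neq0.
have hF_neq0 : iota h != 0 by rewrite (frac_eq0 iotaK).
have P_neq0 : P != 0.
  apply: contra_neq F_neq0 => P_0; move/eqP: def_P.
  by rewrite P_0 rmorph0 scaler_eq0 (negPf c_neq0) => /eqP.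
have P'_neq0 : P' != 0 by apply: contra_neq P_neq0; rewrite def_P' => ->; rewrite mulr0.
have : good (sizeY P').
  exists (c / iota h), P'; split; last by [].
    exact: mulf_neq0 c_neq0 (invr_neq0 hF_neq0).
  rewrite mulrC -scalerA def_P def_P' rmorphM /= map_polyC /= mul_polyC scalerA.
  by rewrite mulVf // scale1r.
move=> /min_n; rewrite -sP def_P' !sizeYE rmorphM /= swapXY_polyC.
rewrite size_mul ?swapXY_eq0 ?map_polyC_eq0 //.
rewrite size_map_polyC.
have h_gt1 := irr_h.1.
have sP_gt0 : (0 < size (swapXY P'))%N by rewrite size_poly_gt0 swapXY_eq0.
rewrite leqNgt -(prednK (ltnW h_gt1)) addSn /= -add1n leq_add2r -ltnS.
by rewrite prednK ?h_gt1 // ltnW.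
Qed.

(* The primitive multiple [P] of [F] in [k[x][T]] divides
   [g(x) f(T) - f(x) g(T)], whose degree in [x] is at most that of [P]; so the
   quotient lies in [k[T]], hence divides both [f] and [g] and is constant. *)
Lemma luroth_degree (F : {poly K}) (i : nat)
    (f g : {poly k}) :
  F \is monic -> g != 0 -> coprimep f g -> F`_i = iota f / iota g ->
  (forall c, F`_i != cst c) ->
  F %| map_poly cst f - F`_i *: map_poly cst g ->
  (size (map_poly cst f
          - F`_i *: map_poly cst g)%R <= size F)%N.
Proof.
set y := F`_i; set E := _ - _ => monF g_neq0 cop_fg def_y y_nconst dvd_FE.
have F_neq0 := monic_neq0 monF.
have [E0|E_neq0] := eqVneq E 0; first by rewrite E0 size_poly0.
have [c [P [c_neq0 def_P primP]]] := primitive_multiple F_neq0.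
pose tof := map_poly iota.
pose D := map_poly polyC f * g%:P - f%:P * map_poly polyC g : {poly {poly k}}.
have gF_neq0 : iota g != 0 by rewrite (frac_eq0 iotaK).
have def_D : tof D = iota g *: E.
  rewrite /tof rmorphB !rmorphM /= !map_polyC /= -!map_cst /E scalerBr.
  by rewrite mulrC !mul_polyC scalerA def_y mulrC (divfK gF_neq0).
(* The scalar comes from g E = (g/c) (E/F) (c F), whose left side is [D] and whose last factor is
   [P]. *)
have [d [Q0 [d_neq0 def_Q0]]] := (clear_denominators iotaK) ((iota g / c) *: (E %/ F)).
have eq_D : d%:P * D = P * Q0.
  apply: (map_inj_poly iotaK.1 (rmorph0 iota)).
  rewrite !rmorphM /= map_polyC /= -/tof def_D /tof -def_P -def_Q0 mul_polyC.
  rewrite -scalerAl -!scalerAr !scalerA -{1}(divpK dvd_FE) [_ * F]mulrC; congr (_ *: _).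
  by rewrite [RHS]mulrC mulrA (divfK c_neq0).
have [Q def_DQ] := gauss_dvd primP d_neq0 eq_D.
have D_neq0 : D != 0.
  apply: contra_neq E_neq0 => D0; move/eqP: def_D.
  by rewrite /tof D0 rmorph0 eq_sym scaler_eq0 (negPf gF_neq0) => /eqP.
have P_neq0 : P != 0 by apply: contra_neq D_neq0; rewrite def_DQ => ->; rewrite mul0r.
have Q_neq0 : Q != 0 by apply: contra_neq D_neq0; rewrite def_DQ => ->; rewrite mulr0.
pose N := (size F).-1.
have FN : F`_N = 1 by apply/eqP; rewrite -/(lead_coef F) -monicE.
have PF j : iota (P`_j) = c * F`_j by rewrite -coefZ def_P coef_map.
(* As [F] is monic, the coefficients i and N of [P] have ratio y = f/g, which is in lowest terms. So
   f divides the first and g the second, and neither f nor g has degree above that of [P] in x. *)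
have eq_Pfg : P`_i * g = P`_N * f.
  apply/eqP; rewrite -(inj_eq iotaK.1) !rmorphM !PF FN mulr1 -/y def_y.
  by rewrite -mulrA (divfK gF_neq0).
have PN_neq0 : P`_N != 0 by rewrite -(frac_eq0 iotaK) PF FN mulr1.
have y_neq0 : y != 0 by rewrite -(rmorph0 cst) y_nconst.
have Pi_neq0 : P`_i != 0 by rewrite -(frac_eq0 iotaK) PF (mulf_neq0 c_neq0 y_neq0).
have le_gP : (size g <= sizeY P)%N.
  apply: leq_trans (max_size_coefXY P N); apply: dvdp_leq => //.
  by rewrite -(Gauss_dvdpl _ (q := f)) 1?coprimep_sym // -eq_Pfg dvdp_mull.
have le_fP : (size f <= sizeY P)%N.
  apply: leq_trans (max_size_coefXY P i); apply: dvdp_leq => //.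
  by rewrite -(Gauss_dvdpl _ (q := g)) // eq_Pfg dvdp_mull.
have le_DP : (sizeY D <= sizeY P)%N.
  apply/bigmax_leqP => j _; move: (nat_of_ord j) => {}j.
  rewrite /D coefB coefMC coefCM !coef_map /=.
  apply: leq_trans (size_polyD _ _) _; rewrite size_polyN geq_max.
  rewrite [f * _]mulrC !mul_polyC; apply/andP.
  by split; apply: leq_trans (size_scale_leq _ _) _.
have [q def_q] : exists q, Q = map_poly polyC q.
  have/size1_polyC def_sQ : (size (swapXY Q) <= 1)%N.
    have sP_gt0 : (0 < size (swapXY P))%N by rewrite size_poly_gt0 swapXY_eq0.
    move: le_DP; rewrite !sizeYE def_DQ rmorphM /= size_mul ?swapXY_eq0 //.
    by rewrite -(prednK sP_gt0) addSn /= -[leqRHS]addn1 leq_add2l.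
  by exists (swapXY Q)`_0; rewrite -swapXY_polyC -def_sQ swapXYK.
have [qf qg] : q %| f /\ q %| g.
  apply: (dvdp_const_pencil y_nconst); rewrite -/E -(dvdpZr _ _ gF_neq0) -def_D def_DQ.
  by rewrite /tof rmorphM /= map_cst -def_q dvdp_mull.
have sq : size q = 1%N.
  apply/eqP; rewrite -dvdp1.
  by move: cop_fg; rewrite -gcdp_eqp1 => /eqp_dvdr <-; rewrite dvdp_gcd qf.
have sizeD : size E = size D.
  rewrite -(size_scale E gF_neq0) -def_D.
  by rewrite size_map_inj_poly ?rmorph0 //; apply: iotaK.1.
rewrite sizeD def_DQ size_mul // def_q size_map_polyC sq addn1 /=.
by rewrite -(size_scale F c_neq0) def_P size_map_inj_poly ?rmorph0 //; apply: iotaK.1.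
Qed.

End RationalFunctions.

(** * Morphisms out of a fraction field, inverses and coefficient lifting *)

Lemma frac_extend (D : idomainType) (K L : fieldType) (iota : {rmorphism D -> K})
    (h : {rmorphism D -> L}) :
  fraction_field iota -> injective h ->
  exists phi : {rmorphism K -> L}, forall a, phi (iota a) = h a.
Proof.
move=> iotaK inj_h.
have h_eq0 a : (h a == 0) = (a == 0) by rewrite -(rmorph0 h) (inj_eq inj_h).
(* Quantifying over all representations of z makes the function given by choice independent of
   them. *)
have ex_phi z : exists w, forall a b, b != 0 -> z = iota a / iota b -> w = h a / h b.
  have [a [b [b_neq0 def_z]]] := iotaK.2 z.
  exists (h a / h b) => a' b' b'_neq0 def_z'.
  apply/eqP; rewrite eqr_div ?h_eq0 // -!rmorphM (inj_eq inj_h).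
  by rewrite -(inj_eq iotaK.1) !rmorphM -eqr_div ?(frac_eq0 iotaK) // -def_z -def_z'.
have [phi phiE] := choice ex_phi.
have phi_frac a b : b != 0 -> phi (iota a / iota b) = h a / h b.
  by move=> b_neq0; apply: phiE.
have phiD : zmod_morphism phi.
  move=> u v; have [a [b [b0 ->]]] := iotaK.2 u; have [c [d [d0 ->]]] := iotaK.2 v.
  rewrite -mulNr addf_div ?(frac_eq0 iotaK) // mulNr -!rmorphM -rmorphB.
  rewrite !phi_frac ?mulf_neq0 // rmorphB !rmorphM.
  by rewrite -[X in _ = _ + X]mulNr addf_div ?h_eq0 // mulNr.
have phiM : monoid_morphism phi.
  split=> [|u v].
    by rewrite -[1](@divff _ (iota 1)) ?rmorph1 ?oner_eq0 // -(rmorph1 iota)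
      phi_frac ?oner_eq0 // rmorph1 divr1.
  have [a [b [b0 ->]]] := iotaK.2 u; have [c [d [d0 ->]]] := iotaK.2 v.
  by rewrite mulf_div -!rmorphM !phi_frac ?mulf_neq0 // !rmorphM mulf_div.
pose phiB := GRing.isZmodMorphism.Build _ _ _ phiD.
pose phiR := GRing.isMonoidMorphism.Build _ _ _ phiM.
exists (HB.pack phi phiB phiR : {rmorphism K -> L}) => a /=.
by rewrite -[iota a]divr1 -(rmorph1 iota) phi_frac ?oner_eq0 // rmorph1 divr1.
Qed.

Lemma frac_coprime (k K : fieldType) (iota : {rmorphism {poly k} -> K}) (z : K) :
  fraction_field iota ->
  exists f g, [/\ g != 0, coprimep f g & z = iota f / iota g].
Proof.
move=> iotaK; have [a [b [b_neq0 ->]]] := iotaK.2 z.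
have d_neq0 : gcdp a b != 0 by rewrite gcdp_eq0 negb_and b_neq0 orbT.
have def_a := divpK (dvdp_gcdl a b); have def_b := divpK (dvdp_gcdr a b).
exists (a %/ gcdp a b), (b %/ gcdp a b); split.
- by apply: contra_neq b_neq0 => b'0; rewrite -def_b b'0 mul0r.
- by rewrite coprimep_div_gcd // b_neq0 orbT.
rewrite -[iota a](congr1 iota def_a) -[iota b](congr1 iota def_b) !rmorphM /=.
by rewrite -mulf_div divff ?mulr1 // (frac_eq0 iotaK).
Qed.

(** P may share factors with G, so it is replaced by its part [gdcop G P] coprime to G, which still
    vanishes at x; a Bezout relation then gives the inverse of G(x). *)
Lemma horner_inverse (F L : fieldType) (phi : {rmorphism F -> L}) (P G : {poly F})
    (x : L) :
  P != 0 -> root (map_poly phi P) x -> ~~ root (map_poly phi G) x ->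
  exists H, (map_poly phi H).[x] * (map_poly phi G).[x] = 1.
Proof.
move=> P_neq0 Px0 Gx_neq0.
have /rootP Dx0 : root (map_poly phi (gdcop G P)) x.
  by rewrite gdcop_map root_gdco ?map_poly_eq0 // Px0.
have [[u v] /= def1] := Bezout_eq1_coprimepP _ _ (coprimep_gdco G P_neq0).
exists v; have := congr1 (fun q => (map_poly phi q).[x]) def1.
by rewrite rmorphD !rmorphM /= rmorph1 hornerD !hornerM Dx0 mulr0 add0r hornerC.
Qed.

Lemma lift_poly (A : comNzRingType) (S : subringClosed A) (p : {poly A}) :
  (forall i, p`_i \in S) ->
  exists P : {poly subring_of S}, p = map_poly val P.
Proof.
move=> pS; exists (\poly_(i < size p) insubd 0 (p`_i)).
apply/polyP => i; rewrite coef_map coef_poly /=.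
by case: ltnP => [_|le_pi]; rewrite ?insubdK // nth_default.
Qed.

(** * Substitutions in k(x) and subfields as their images *)

Section Substitution.
Variables (k K : fieldType) (iota : {rmorphism {poly k} -> K}).
Hypothesis iotaK : fraction_field iota.

Let cst : {rmorphism k -> K} := iota \o polyC.
Let x := iota 'X.

Lemma pencil_root (f g : {poly k}) : g != 0 ->
  (map_poly cst f - (iota f / iota g) *: map_poly cst g).[x] = 0.
Proof.
move=> g_neq0; rewrite hornerD hornerN hornerZ !horner_cst.
by rewrite divfK ?subrr // (frac_eq0 iotaK).
Qed.

Lemma pencil_neq0 (y : K) (f g : {poly k}) :
  (forall c, y != cst c) -> g != 0 -> map_poly cst f - y *: map_poly cst g != 0.
Proof.
move=> y_nconst g_neq0; apply: contra_neq g_neq0 => E0.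
have := @dvdp_const_pencil _ _ cst y 0 f g y_nconst.
by rewrite E0 dvdp0 => /(_ isT)[_]; rewrite dvd0p => /eqP.
Qed.

(** If a nonconstant y = f/g were algebraic over k, then x, a root of f(T) - y g(T), would be
    integral over k. But a monic p over k takes the nonzero value p at x. *)
Lemma algebraic_const (y : K) : algebraicOver cst y -> exists c, y = cst c.
Proof.
move=> /integral_algebraic y_int; apply: contrapT => /forallNP y_nconst.
have {}y_nconst c : y != cst c by apply/eqP/y_nconst.
have [f [g [g_neq0 _ def_y]]] := frac_coprime y iotaK.
have [p p_mon] : integralOver cst x; last first.
  rewrite /root horner_cst (frac_eq0 iotaK); apply/negP; exact: monic_neq0.
apply: (integral_root (pencil_neq0 f y_nconst g_neq0)).
  by rewrite def_y /root pencil_root.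
apply/integral_poly => i; rewrite coefB coefZ !coef_map.
apply: integral_sub; first exact: integral_id.
exact: integral_mul y_int (integral_id _ _).
Qed.

(** A nonconstant y is transcendental over k, so evaluation at y is injective on polynomials and
    extends to fractions. *)
Lemma subst_exists (y : K) : (forall c, y != cst c) ->
  exists phi : {rmorphism K -> K}, forall p, phi (iota p) = (map_poly cst p).[y].
Proof.
move=> y_nconst.
apply: (frac_extend (h := horner_eval y \o map_poly cst)) => //.
apply: raddf_inj => p /= py0; apply: contrapT => /eqP p_neq0.
have [|c y_c] := @algebraic_const y; first by exists p => //; apply/rootP.
by have /eqP := y_nconst c.
Qed.

Lemma subring_inv (S : subringClosed K) (z : K) :
  is_field (subring_of S) -> z \in S -> z^-1 \in S.
Proof.
move=> fieldS Sz; have [->|z_neq0] := eqVneq z 0; first by rewrite invr0 rpred0.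
have [|w zw1] := fieldS (Subring Sz); first by rewrite -val_eqE.
suff -> : z^-1 = val w by apply: valP.
by apply: (mulfI z_neq0); rewrite divff // -[LHS](congr1 val zw1).
Qed.

(** The last hypothesis says that x is algebraic over S. The field k(y) is presented as the image of
    the k-endomorphism sending x to y. *)
Lemma luroth (S : subringClosed K) :
  is_field (subring_of S) -> (forall c, cst c \in S) ->
  (exists2 G : {poly subring_of S}, G != 0 & (map_poly val G).[x] = 0) ->
  exists phi : {rmorphism K -> K},
    (forall c, phi (cst c) = cst c) /\
    (forall z, z \in S <-> exists v, phi v = z).
Proof.
move=> fieldS cstS [G1 G1_neq0 G1x].
pose ev (G : {poly subring_of S}) := (map_poly val G).[x].
pose bad n := exists G, [/\ G != 0, ev G = 0 & size G = n].
(* A nonzero annihilator of x of least size, made monic below, serves as minimal polynomial;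
   [subring_of S] carries only a ring structure. *)
have [|n [G0 [G0_neq0 G0x sG0]] min_n] := @min_witness bad.
  by exists (size G1), G1.
have [b lb1] : exists b, lead_coef G0 * b = 1 by apply: fieldS; rewrite lead_coef_eq0.
pose F := G0 * b%:P.
have evM G H : ev (G * H) = ev G * ev H by rewrite /ev rmorphM hornerM.
have evB G H : ev (G - H) = ev G - ev H by rewrite /ev rmorphB hornerD hornerN.
have evC c : ev c%:P = val c by rewrite /ev map_polyC hornerC.
have Fx : ev F = 0 by rewrite evM G0x mul0r.
have sF : (size F <= n)%N.
  by rewrite -sG0 /F mulrC mul_polyC size_scale_leq.
have monF : F \is monic.
  by rewrite monicE lead_coef_proper_mul lead_coefC lb1 ?oner_neq0.
have minF G : ev G = 0 -> (size G < size F)%N -> G = 0.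
  move=> Gx; apply: contraTeq => G_neq0; rewrite -leqNgt (leq_trans sF) //.
  by apply: min_n; exists G.
pose FK := map_poly val F : {poly K}.
have monFK : FK \is monic by apply: monic_map.
have sFK : size FK = size F by rewrite size_map_inj_poly ?rmorph0 //; apply: val_inj.
have F_gt1 : (1 < size F)%N.
  rewrite ltnNge; apply/negP => F_le1; move: Fx; rewrite /ev -/FK.
  have FK_le1 : (size FK <= 1)%N by rewrite sFK.
  have := monFK; rewrite (size1_polyC FK_le1) monicE lead_coefC => /eqP ->.
  by rewrite hornerC => /eqP; rewrite oner_eq0.
(* Otherwise x would be a root of a nonzero polynomial over k. *)
have [i y_nconst] : exists i, forall c, FK`_i != cst c.
  apply: contrapT => /forallNP constF.
  have /choice[c cE] : forall i, exists c, FK`_i = cst c.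
    move=> i; apply: contrapT => /forallNP ncst; apply: (constF i) => c.
    exact/eqP/ncst.
  have FKE : FK = map_poly cst (\poly_(i < size FK) c i).
    apply/polyP => i; rewrite [RHS]coef_map coef_poly.
    case: ltnP => [_|le_i]; first exact: cE.
    by rewrite raddf0 nth_default.
  have /eqP := monic_neq0 monFK; apply.
  move/eqP: Fx; rewrite /ev -/FK FKE horner_cst (frac_eq0 iotaK) => /eqP ->.
  by rewrite rmorph0.
pose y := FK`_i; have Sy : y \in S by rewrite /y coef_map; apply: valP.
have [f [g [g_neq0 cop_fg def_y]]] := frac_coprime y iotaK.
pose E := map_poly cst f - y *: map_poly cst g.
have Ex : E.[x] = 0 by rewrite /E def_y pencil_root.
have E_neq0 : E != 0 by apply: pencil_neq0.
have [|EA def_EA] := @lift_poly _ S E.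
  by move=> j; rewrite coefB coefZ !coef_map rpredB ?rpredM ?cstS.
(* [F] is minimal over [S], and the pencil [E] is a polynomial over [S]
   vanishing at [x]; [luroth_degree] then bounds its size by that of [F]. *)
have dvd_FE : FK %| E.
  have r0 : Pdiv.Ring.rmodp EA F = 0.
    apply: minF; last by rewrite Pdiv.Ring.ltn_rmodp monic_neq0.
    have : ev EA = 0 by rewrite /ev -def_EA.
    rewrite {1}(Pdiv.RingMonic.rdivp_eq monF EA) /ev rmorphD hornerD rmorphM hornerM.
    by rewrite -!/(ev _) Fx mulr0 add0r.
  rewrite def_EA (Pdiv.RingMonic.rdivp_eq monF EA) r0 addr0 rmorphM.
  exact: dvdp_mull.
have le_EF : (size E <= size F)%N.
  by rewrite -sFK; apply: (luroth_degree iotaK monFK g_neq0 cop_fg def_y).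
have [phi phiE] := subst_exists y_nconst.
have phi_cst c : phi (cst c) = cst c by rewrite phiE map_polyC hornerC.
have phi_x : phi x = y by rewrite phiE map_polyX hornerX.
have phiS z : phi z \in S.
  have phipS p : phi (iota p) \in S.
    rewrite phiE horner_coef rpred_sum // => j _.
    by rewrite coef_map rpredM ?rpredX ?cstS.
  have [p [q [_ ->]]] := iotaK.2 z; rewrite fmorph_div rpredM ?phipS //.
  exact: subring_inv (phipS q).
(* Since phi x = y, this is the preimage of [E] under [phi]: computations over k(y) modulo [E] are
   carried out over the field [K] modulo [FB]. *)
pose FB := map_poly cst f - x *: map_poly cst g.
have phi_map p : map_poly phi (map_poly cst p) = map_poly cst p.
  by apply/polyP => j; rewrite !coef_map; apply: phi_cst.
have phiFB : map_poly phi FB = E.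
  by rewrite rmorphB /= map_polyZ !phi_map -/x phi_x.
have FB_neq0 : FB != 0.
  by apply: contra_neq E_neq0; rewrite -phiFB => ->; rewrite rmorph0.
have sFB : size FB = size E by rewrite -phiFB size_map_poly.
exists phi; split=> // z; split=> [Sz|[v <-] //].
(* Any [z] is the value at [x] of a polynomial over [k(y)] of size less than
   that of [F]; if [z] is in [S], minimality of [F] makes it constant. *)
have [G def_z] : exists G, z = (map_poly phi G).[x].
  have [a [d [d_neq0 def_z]]] := iotaK.2 z.
  have [|||H Hd] := @horner_inverse _ _ phi FB (map_poly cst d) x.
  - exact: FB_neq0.
  - by rewrite /root phiFB Ex.
  - by rewrite /root phi_map horner_cst (frac_eq0 iotaK).
  exists (map_poly cst a * H); rewrite rmorphM hornerM /= phi_map def_z.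
  move: Hd; rewrite phi_map !horner_cst => Hd; congr (_ * _).
  by rewrite -[LHS]mul1r -Hd mulfK // (frac_eq0 iotaK).
pose G' := G %% FB.
have def_z' : z = (map_poly phi G').[x].
  rewrite def_z {1}(divp_eq G FB) rmorphD hornerD rmorphM hornerM /= phiFB Ex.
  by rewrite mulr0 add0r.
have sG' : (size G' < size F)%N.
  by rewrite (leq_trans _ le_EF) // -sFB ltn_modp.
have [|GA def_GA] := @lift_poly _ S (map_poly phi G').
  by move=> j; rewrite coef_map; apply: phiS.
have sGA : size GA = size G'.
  rewrite -(size_map_poly phi G') def_GA.
  by rewrite size_map_inj_poly ?rmorph0 //; apply: val_inj.
have /eqP : GA - (Subring Sz)%:P = 0.
  apply: minF.
    by rewrite evB evC /ev -def_GA -def_z' subrr.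
  rewrite (leq_ltn_trans (size_polyD _ _)) // gtn_max sGA sG' size_polyN.
  by rewrite (leq_ltn_trans (size_polyC_leq1 _)).
rewrite subr_eq0 => /eqP def_GA'; exists G'`_0.
have := congr1 (fun p : {poly K} => p`_0) def_GA.
by rewrite def_GA' map_polyC coefC coef_map.
Qed.
End Substitution.

(** * Maximal subrings of a field *)

Definition adjoin (A : comNzRingType) (S : subringClosed A) (u : A) : {pred A} :=
  fun z => `[< exists P : {poly subring_of S}, z = (map_poly val P).[u] >].

Section Adjoin.
Variables (A : comNzRingType) (S : subringClosed A) (u : A).

Lemma adjoinP z :
  reflect (exists P : {poly subring_of S}, z = (map_poly val P).[u])
          (z \in adjoin S u).
Proof. exact: asboolP. Qed.

Fact adjoin_subring_closed : subring_closed (adjoin S u).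
Proof.
split=> [|_ _ /adjoinP[P ->] /adjoinP[Q ->]|_ _ /adjoinP[P ->] /adjoinP[Q ->]].
- by apply/adjoinP; exists 1; rewrite rmorph1 hornerC.
- by apply/adjoinP; exists (P - Q); rewrite rmorphB hornerD hornerN.
- by apply/adjoinP; exists (P * Q); rewrite rmorphM hornerM.
Qed.

HB.instance Definition _ :=
  GRing.isSubringClosed.Build A (adjoin S u) adjoin_subring_closed.

Lemma maximal_adjoin : maximal_subring S -> u \notin S -> forall z, z \in adjoin S u.
Proof.
move=> [_ maxS] uNS z; apply: contraNT uNS => zNT.
apply: (maxS (adjoin S u)); first by exists z.
  by move=> s Ss; apply/adjoinP; exists (Subring Ss)%:P; rewrite map_polyC hornerC.
by apply/adjoinP; exists 'X; rewrite map_polyX hornerX.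
Qed.
End Adjoin.

(** * Maximal subrings that are not fields: integral closure and valuation property *)

Section Valuation.
Variables (K : fieldType) (S : subringClosed K).

(* Multiply an integral equation of degree [m.+1] by [w^-1 ^+ m]. *)
Lemma integral_mem (w : K) :
  integralOver (val : subring_of S -> K) w -> w^-1 \in S -> w \in S.
Proof.
move=> [p0 mon_p0 /rootP pw0] Sw'.
have [->|w_neq0] := eqVneq w 0; first exact: rpred0.
move: (map_poly _ _) (monic_map val mon_p0) (coef_map val p0) pw0 => p mon_p pE pw0.
have pS i : p`_i \in S by rewrite pE; apply: valP.
case sp : (size p) => [|[|m]].
- by have := monic_neq0 mon_p; rewrite -size_poly_gt0 sp.
- move: mon_p pw0; rewrite (size1_polyC (_ : size p <= 1)%N) ?sp // monicE lead_coefC.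
  by move=> /eqP ->; rewrite hornerC => /eqP; rewrite oner_eq0.
have p1 : p`_m.+1 = 1 by apply/eqP; rewrite -[m.+1]/(m.+2.-1) -sp -monicE.
move: pw0; rewrite horner_coef sp big_ord_recr /= p1 mul1r.
move=> /eqP; rewrite addrC addr_eq0 => /eqP eq_w.
have -> : w = - \sum_(i < m.+1) p`_i * w^-1 ^+ (m - i).
  apply: (mulIf (expf_neq0 m w_neq0)); rewrite -exprS eq_w mulNr big_distrl /=.
  congr (- _); apply: eq_bigr => i _; rewrite -mulrA; congr (_ * _).
  rewrite exprVn -[X in _ * w ^+ X](subnKC (leq_ord i)) exprD mulrCA.
  by rewrite mulVf ?mulr1 // expf_neq0.
by rewrite rpredN rpred_sum // => i _; rewrite rpredM ?rpredX.
Qed.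

Hypothesis maxS : maximal_subring S.
Hypothesis nfieldS : ~ is_field (subring_of S).

(** If an integral u lay outside S, then K = S[u] would be integral over S. The inverse of a nonzero
    element of S, being integral, would lie in S by [integral_mem], making S a field. *)
Lemma maximal_integral_mem (u : K) :
  integralOver (val : subring_of S -> K) u -> u \in S.
Proof.
move=> int_u; apply: contrapT => /negP uNS; apply: nfieldS => a a_neq0.
have Sa' : (val a)^-1 \in S.
  apply: integral_mem; last by rewrite invrK; apply: valP.
  have /adjoinP[P ->] := maximal_adjoin maxS uNS (val a)^-1.
  apply: integral_horner => //; apply/integral_poly => i.
  by rewrite coef_map; apply: integral_id.
by exists (Subring Sa'); apply: val_inj; rewrite /= divff.
Qed.

(* If [u] and [u^-1] were both outside [S], maximality would give
   [u \in S[u^-1]], an integral equation for [u] over [S]. *)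
Lemma maximal_valuation (u : K) : u \notin S -> u^-1 \in S.
Proof.
move=> uNS; apply: contraNT (uNS) => u'NS; apply: maximal_integral_mem.
have u_neq0 : u != 0 by apply: contraNneq uNS => ->; apply: rpred0.
have /adjoinP[P def_u] := maximal_adjoin maxS u'NS u.
move: (map_poly _ _) (coef_map val P) def_u => p pE def_u.
have pS i : p`_i \in S by rewrite pE; apply: valP.
(* Obtained from u = p(1/u) on multiplying by the power [size p] of u. *)
pose q : {poly K} := 'X^((size p).+1) - \sum_(i < size p) p`_i *: 'X^(size p - i).
have mon_q : q \is monic.
  rewrite monicE lead_coefDl ?lead_coefXn // size_polyN size_polyXn ltnS.
  apply: (leq_trans (size_sum _ _ _)); apply/bigmax_leqP => i _.
  by rewrite (leq_trans (size_scale_leq _ _)) // size_polyXn ltnS leq_subr.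
have [|Q def_q] := @lift_poly _ S q.
  move=> j; rewrite coefB coefXn coef_sum rpredB ?rpred_nat ?rpred_sum // => i _.
  by rewrite coefZ coefXn rpredM ?rpred_nat.
exists Q.
  move: mon_q; rewrite !monicE def_q lead_coef_map_inj ?rmorph0 //; exact: val_inj.
rewrite -def_q /root /q hornerD hornerN hornerXn horner_sum.
rewrite exprSr [X in _ * X]def_u horner_coef mulr_sumr subr_eq0.
apply/eqP/eq_bigr => i _.
rewrite hornerZ hornerXn mulrCA; congr (_ * _).
rewrite exprVn -[X in u ^+ X * _](subnKC (ltnW (ltn_ord i))) exprD mulrAC.
by rewrite divff ?mul1r // expf_neq0.
Qed.
End Valuation.

(** * Maximal subrings that are not fields, over algebraically closed constants *)

Section ClosedConstants.
Variables (k K : fieldType) (iota : {rmorphism {poly k} -> K}).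
Hypothesis iotaK : fraction_field iota.

Let cst : {rmorphism k -> K} := iota \o polyC.
Let x := iota 'X.

Lemma X_nonconst (c : k) : x != cst c.
Proof.
by rewrite -subr_eq0 -rmorphB (frac_eq0 iotaK) polyXsubC_eq0.
Qed.

Lemma subst_surj (phi : {rmorphism K -> K}) (w : K) :
  (forall c, phi (cst c) = cst c) -> phi w = x -> forall z, exists v, phi v = z.
Proof.
move=> phi_cst phi_w z.
have phi_eval p : phi (map_poly cst p).[w] = iota p.
  rewrite -[RHS]horner_cst -horner_map phi_w; congr (_.[_]).
  by apply/polyP => i; rewrite !coef_map; apply: phi_cst.
have [a [b [_ ->]]] := iotaK.2 z.
by exists ((map_poly cst a).[w] / (map_poly cst b).[w]); rewrite fmorph_div !phi_eval.
Qed.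

(** The map sends x to s - c, hence x + c to s. So x is the image of x + c or of its inverse, which
    gives surjectivity. *)
Lemma affine_subst (s : K) (c : k) : s = x \/ s = x^-1 ->
  exists phi : {rmorphism K -> K},
    [/\ forall p, phi (iota p) = (map_poly cst p).[s - cst c],
        forall d, phi (cst d) = cst d & forall z, exists v, phi v = z].
Proof.
move=> s_x.
have s_nconst d : s - cst c != cst d.
  rewrite subr_eq -rmorphD; case: s_x => ->; first exact: X_nonconst.
  by rewrite -(inj_eq invr_inj) invrK -fmorphV X_nonconst.
have [phi phiE] := subst_exists iotaK s_nconst.
have phi_cst d : phi (cst d) = cst d by rewrite phiE map_polyC hornerC.
have phi_s : phi (x + cst c) = s.
  by rewrite rmorphD phi_cst phiE map_polyX hornerX subrK.
exists phi; split=> //.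
case: s_x => s_x; first by apply: (@subst_surj phi (x + cst c)); rewrite // phi_s.
by apply: (@subst_surj phi (x + cst c)^-1 phi_cst); rewrite fmorphV phi_s s_x invrK.
Qed.

Variable S : subringClosed K.
Hypothesis cstS : forall c, cst c \in S.

Lemma horner_mem (t : K) (p : {poly k}) : t \in S -> (map_poly cst p).[t] \in S.
Proof.
move=> St; rewrite horner_coef rpred_sum // => i _.
by rewrite coef_map rpredM ?rpredX ?cstS.
Qed.

(** Over algebraically closed k, p splits, and 1/p(t) is a constant times a product of inverses of t
    - c over the roots c. *)
Lemma horner_inv_mem (t : K) (p : {poly k}) :
  GRing.closed_field_axiom k ->
  (forall c, root p c -> (t - cst c)^-1 \in S) -> ((map_poly cst p).[t])^-1 \in S.
Proof.
move=> closed_k.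
have [n] := ubnP (size p); elim: n p => // n IHn p /ltnSE le_pn rootS.
have [->|p_neq0] := eqVneq p 0; first by rewrite rmorph0 horner0 invr0 rpred0.
have [/eqP/size_poly1P[c _ ->]|/(PreClosedField.closed_rootP closed_k)[c pc]] :=
  eqVneq (size p) 1%N.
  by rewrite map_polyC hornerC -fmorphV cstS.
have [q def_p] := factor_theorem _ _ pc.
have q_neq0 : q != 0 by apply: contra_neq p_neq0; rewrite def_p => ->; rewrite mul0r.
rewrite def_p rmorphM hornerM rmorphB /= map_polyX map_polyC hornerXsubC invfM.
rewrite rpredM ?rootS // IHn //.
  by apply: leq_trans le_pn; rewrite def_p size_Mmonic ?monicXsubC // size_XsubC addn2.
by move=> d qd; apply: rootS; rewrite def_p rootM qd.
Qed.

(** The last clause says that the preimage of S under the k-automorphism [phi] is k[x] localized at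
    (x), tested on fractions in lowest terms. *)
Lemma maximal_nonfield :
  GRing.closed_field_axiom k -> maximal_subring S -> ~ is_field (subring_of S) ->
  exists phi : {rmorphism K -> K},
    [/\ forall c, phi (cst c) = cst c, forall z, exists v, phi v = z
      & forall f g, coprimep f g -> g != 0 ->
          (phi (iota f / iota g) \in S) = ~~ root g 0].
Proof.
move=> closed_k maxS nfieldS.
have [s s_x Ss] : exists2 s, s = x \/ s = x^-1 & s \in S.
  have [Sx|xNS] := boolP (x \in S); first by exists x; [left|].
  by exists x^-1; [right|apply: maximal_valuation].
(* If all these inverses were in S, then S would contain every quotient of polynomials in s, which
   is all of K. *)
have [c tNS] : exists c, (s - cst c)^-1 \notin S.
  apply: contrapT => /forallNP allS; have [[z zNS] _] := maxS.
  have [phi [phiE _ phi_surj]] := affine_subst 0 s_x.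
  have [v def_z] := phi_surj z; case/negP: zNS; rewrite -def_z.
  have [a [b [_ ->]]] := iotaK.2 v; rewrite fmorph_div !phiE rmorph0 subr0.
  rewrite rpredM ?horner_mem // horner_inv_mem // => d _.
  by apply: contrapT => /negP; apply: allS.
have [phi [phiE phi_cst phi_surj]] := affine_subst c s_x.
pose t := s - cst c; have St : t \in S by rewrite rpredB.
have phi_x : phi x = t by rewrite phiE map_polyX hornerX.
have tdS d : d != 0 -> (t - cst d)^-1 \in S.
  move=> d_neq0; apply: contrapT => /negP tdNS.
  have cd_neq0 : cst d != 0 by rewrite fmorph_eq0.
  have td_neq0 : t - cst d != 0 by apply: contraNneq tdNS => ->; rewrite invr0 rpred0.
  have t_neq0 : t != 0 by apply: contraNneq tNS => t0; rewrite -/t t0 invr0 rpred0.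
  (* Were [t] and [t - d] both non-units, neither their quotient nor its inverse
     would lie in [S]. *)
  have vNS : t / (t - cst d) \notin S.
    apply: contra tdNS => Sv.
    have -> : (t - cst d)^-1 = (t / (t - cst d) - 1) * cst d^-1.
      by rewrite fmorphV; field; rewrite cd_neq0 td_neq0.
    by rewrite rpredM ?rpredB ?rpred1.
  have := maximal_valuation maxS nfieldS vNS; rewrite invfM invrK => Sv'.
  case/negP: tNS; rewrite -/t.
  have -> : t^-1 = (1 - t^-1 * (t - cst d)) * cst d^-1.
    by rewrite fmorphV; field; rewrite cd_neq0 t_neq0.
  by rewrite rpredM ?rpredB ?rpred1.
have unitS g : ~~ root g 0 -> (phi (iota g))^-1 \in S.
  move=> g0; rewrite phiE horner_inv_mem // => d gd; apply: tdS.
  by apply: contraNneq g0 => <-.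
have memS p : phi (iota p) \in S by rewrite phiE horner_mem.
exists phi; split=> // f g cop_fg g_neq0; apply/idP/idP => [Sfg|g0]; last first.
  by rewrite fmorph_div rpredM ?unitS.
(* If g = h x, coprimality gives f(0) nonzero, so [phi] maps f to a unit of S, and 1/x = (f/g) h / f
   would put the inverse of t in S. *)
apply/negP => g0; case/negP: tNS; rewrite -/t -phi_x.
have f0 : ~~ root f 0.
  by apply: contraL g0 => f0; apply: coprimep_root f0.
have [h def_g] := factor_theorem _ _ g0.
rewrite subr0 in def_g.
have -> : (phi x)^-1 = phi (iota f / iota g) * phi (iota h) * (phi (iota f))^-1.
  have h_neq0 : h != 0 by apply: contra_neq g_neq0; rewrite def_g => ->; rewrite mul0r.
  have f_neq0 : f != 0 by apply: contraNneq f0 => ->; apply: root0.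
  rewrite -!fmorphV -!rmorphM; congr (phi _).
  by rewrite def_g rmorphM /x; field; rewrite !(frac_eq0 iotaK) f_neq0 polyX_eq0 h_neq0.
by rewrite rpredM ?unitS ?rpredM ?memS.
Qed.
End ClosedConstants.

(** * Isomorphisms over k and localizations at irreducible polynomials *)

Lemma bijective_rmorph_inverse (A B : comNzRingType) (f : {rmorphism A -> B}) :
  injective f -> (forall b, exists a, f a = b) ->
  exists g : {rmorphism B -> A}, cancel f g /\ cancel g f.
Proof.
move=> inj_f /choice[g gK]; have fK : cancel f g by move=> a; apply: inj_f; rewrite gK.
pose gB := GRing.isZmodMorphism.Build _ _ g (can2_zmod_morphism fK gK).
pose gM := GRing.isMonoidMorphism.Build _ _ g (can2_monoid_morphism fK gK).
by exists (HB.pack g gB gM : {rmorphism B -> A}).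
Qed.

Lemma corestriction (A K : comNzRingType) (S : subringClosed K)
    (f : {rmorphism A -> K}) :
  (forall a, f a \in S) ->
  exists g : {rmorphism A -> subring_of S}, forall a, val (g a) = f a.
Proof.
move=> fS; pose g a := Subring (fS a).
have gB : zmod_morphism g by move=> a b; apply: val_inj; rewrite /= rmorphB.
have gM : monoid_morphism g.
  by split=> [|a b]; apply: val_inj; rewrite /= ?rmorph1 ?rmorphM.
pose gZ := GRing.isZmodMorphism.Build _ _ g gB.
pose gR := GRing.isMonoidMorphism.Build _ _ g gM.
by exists (HB.pack g gZ gR : {rmorphism A -> subring_of S}).
Qed.

Lemma is_field_bijective (A : comNzRingType) (L : fieldType) (f : {rmorphism A -> L}) :
  bijective f -> is_field A.
Proof.
move=> bij_f a a_neq0; have [g fK gK] := bij_f.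
have inj_f := can_inj fK.
exists (g (f a)^-1); apply: (inj_f); rewrite rmorphM gK rmorph1 divff //.
by rewrite -(rmorph0 f) (inj_eq inj_f).
Qed.

Section Local.
Variables (k K : fieldType) (iota : {rmorphism {poly k} -> K}).
Hypothesis iotaK : fraction_field iota.

Let cst : {rmorphism k -> K} := iota \o polyC.
Let x := iota 'X.

Lemma k_isomorphic_image (S : subringClosed K) (kS : forall c, cst c \in S)
    (phi : {rmorphism K -> K}) :
  (forall c, phi (cst c) = cst c) -> (forall z, z \in S <-> exists v, phi v = z) ->
  k_isomorphic (fun c => Subring (kS c)) cst.
Proof.
move=> phi_cst phiS.
have [|g gE] := @corestriction K K S phi; first by move=> v; apply/phiS; exists v.
have [||h [gK hK]] := bijective_rmorph_inverse (f := g).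
- by move=> u v /(congr1 val); rewrite !gE; apply: fmorph_inj.
- move=> s; have [v def_s] := (phiS (val s)).1 (valP s).
  by exists v; apply: val_inj; rewrite gE.
exists h; split=> [|c]; first by exists g.
by rewrite -[RHS]gK; congr (h _); apply: val_inj; rewrite gE phi_cst.
Qed.

(** To apply [luroth], x must be algebraic over S. If x is not in S, maximality gives 1/x = P(x)
    with P over S, and X P - 1 annihilates x; it is nonzero because its constant term is -1. *)
Lemma maximal_field_k_isomorphic (S : subringClosed K) (kS : forall c, cst c \in S) :
  maximal_subring S -> is_field (subring_of S) ->
  k_isomorphic (fun c => Subring (kS c)) cst.
Proof.
move=> maxS fieldS.
have [|phi [phi_cst phiS]] := luroth iotaK fieldS kS; last first.
  exact: k_isomorphic_image phiS.
pose ev (P : {poly subring_of S}) := (map_poly val P).[x].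
have evX : ev 'X = x by rewrite /ev map_polyX hornerX.
have evC c : ev c%:P = val c by rewrite /ev map_polyC hornerC.
have evB P Q : ev (P - Q) = ev P - ev Q by rewrite /ev rmorphB hornerD hornerN.
have evM P Q : ev (P * Q) = ev P * ev Q by rewrite /ev rmorphM hornerM.
have [Sx|xNS] := boolP (x \in S).
  exists ('X - (Subring Sx)%:P); first by rewrite polyXsubC_eq0.
  by rewrite -/(ev _) evB evX evC subrr.
have x_neq0 : x != 0 by rewrite (frac_eq0 iotaK) polyX_eq0.
have /adjoinP[P def_P] := maximal_adjoin maxS xNS x^-1.
exists ('X * P - 1).
  apply/eqP => /(congr1 (fun p : {poly _} => p`_0)).
  by rewrite coefB coefXM coef1 coef0 sub0r => /eqP; rewrite oppr_eq0 oner_eq0.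
by rewrite -/(ev _) evB evM evX evC -{1}[x]invrK {1}/ev -def_P mulVf ?invr_eq0 // subrr.
Qed.

(** For p irreducible, S is k[x] localized at (p). Restricting to lowest terms makes membership a
    condition on the denominator alone. *)
Definition local_at (p : {poly k}) (S : subringClosed K) : Prop :=
  forall f g, coprimep f g -> g != 0 -> (iota f / iota g \in S) = ~~ (p %| g).

Lemma local_at_poly p S f : irreducible_poly p -> local_at p S -> iota f \in S.
Proof.
move=> irr_p locS; rewrite -[iota f]divr1 -(rmorph1 iota) locS ?coprimep1 ?oner_eq0 //.
by rewrite irredp_dvd1.
Qed.

Lemma local_at_inv p S g : local_at p S -> g != 0 -> (iota g)^-1 \in S = ~~ (p %| g).
Proof.
by move=> locS g_neq0; rewrite -div1r -(rmorph1 iota) locS // coprime1p.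
Qed.

Lemma local_nonfield p S :
  irreducible_poly p -> local_at p S -> ~ is_field (subring_of S).
Proof.
move=> irr_p locS fieldS; have := local_at_inv locS (irredp_neq0 irr_p).
by rewrite dvdpp (subring_inv fieldS (local_at_poly p irr_p locS)).
Qed.

(** An element f/g in lowest terms outside S has p dividing g but not f, so 1/p = (f/g) (g/p) / f
    lies in any larger ring containing S and f/g. With 1/p, that ring contains the inverses of all
    polynomials. *)
Lemma local_maximal p S : irreducible_poly p -> local_at p S -> maximal_subring S.
Proof.
move=> irr_p locS; have p_neq0 := irredp_neq0 irr_p.
split; first by exists (iota p)^-1; rewrite (local_at_inv locS) // dvdpp.
move=> T [w wNT] sST z Tz; apply: contraNT wNT => zNS.
have sT f : iota f \in T by apply/sST/(local_at_poly _ irr_p locS).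
have Tp' : (iota p)^-1 \in T.
  have [f [g [g_neq0 cop_fg def_z]]] := frac_coprime z iotaK.
  move: zNS; rewrite def_z locS // negbK => dvd_pg.
  have ndvd_pf : ~~ (p %| f).
    by apply/negP => dvd_pf; apply: irredp_dvd_coprime irr_p cop_fg dvd_pf dvd_pg.
  have f_neq0 : f != 0 by apply: contraNneq ndvd_pf => ->; apply: dvdp0.
  have -> : (iota p)^-1 = z * (iota (g %/ p) * (iota f)^-1).
    rewrite def_z -{1}(divpK dvd_pg) rmorphM; field.
    by rewrite !(frac_eq0 iotaK) f_neq0 p_neq0 dvdp_div_eq0 ?g_neq0.
  by rewrite rpredM // rpredM // sST // (local_at_inv locS).
have Tinv b : (iota b)^-1 \in T.
  have [n] := ubnP (size b); elim: n b => // n IHn b /ltnSE le_bn.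
  have [->|b_neq0] := eqVneq b 0; first by rewrite rmorph0 invr0 rpred0.
  have [dvd_pb|ndvd_pb] := boolP (p %| b); last by rewrite sST // (local_at_inv locS).
  rewrite -(divpK dvd_pb) rmorphM invfM rpredM // IHn //.
  rewrite (leq_trans _ le_bn) // size_divp // ltn_subrL size_poly_gt0 b_neq0.
  by rewrite -subn1 subn_gt0 irr_p.
by have [a [b [_ ->]]] := iotaK.2 w; rewrite rpredM.
Qed.

Lemma k_isomorphic_local (S S' : subringClosed K) (kS : forall c, cst c \in S)
    (kS' : forall c, cst c \in S') :
  GRing.closed_field_axiom k -> maximal_subring S -> ~ is_field (subring_of S) ->
  local_at 'X S' ->
  k_isomorphic (fun c => Subring (kS c)) (fun c => Subring (kS' c)).
Proof.
move=> closed_k maxS nfieldS locS'.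
have [phi [phi_cst phi_surj phiS]] := maximal_nonfield iotaK kS closed_k maxS nfieldS.
have {}phiS z : (phi z \in S) = (z \in S').
  have [f [g [g_neq0 cop_fg ->]]] := frac_coprime z iotaK.
  by rewrite phiS // locS' // -['X]subr0 dvdp_XsubCl.
have [|g gE] := @corestriction (subring_of S') K S (phi \o val).
  by move=> s /=; rewrite phiS; apply: valP.
have [||h [gK hK]] := bijective_rmorph_inverse (f := g).
- by move=> u v /(congr1 val); rewrite !gE => /fmorph_inj/val_inj.
- move=> s; have [v def_s] := phi_surj (val s).
  have S'v : v \in S' by rewrite -phiS def_s; apply: valP.
  by exists (Subring S'v); apply: val_inj; rewrite gE.
exists h; split=> [|c]; first by exists g.
by rewrite -[RHS]gK; congr (h _); apply: val_inj; rewrite gE /= phi_cst.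
Qed.

(* The residue field of the local ring at 'X is [k], so [x] is congruent to a
   constant modulo the maximal ideal of [S]. *)
Lemma local_residue p (S S' : subringClosed K) (kS : forall c, cst c \in S)
    (kS' : forall c, cst c \in S') :
  irreducible_poly p -> local_at p S -> local_at 'X S' ->
  k_isomorphic (fun c => Subring (kS c)) (fun c => Subring (kS' c)) ->
  exists c, root p c.
Proof.
move=> irr_p locS locS' [f [_ f_cst]].
have S'P z : z \in S' -> exists a b, b.[0] != 0 /\ z = iota a / iota b.
  have [a [b [b_neq0 cop_ab ->]]] := frac_coprime z iotaK.
  by rewrite locS' // -['X]subr0 dvdp_XsubCl => b0; exists a, b.
have iota_neq0 b : b.[0] != 0 -> iota b != 0.
  by rewrite (frac_eq0 iotaK); apply: contra_neq => ->; rewrite horner0.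
have Sx : x \in S by apply: local_at_poly irr_p locS.
have [u [s [s0 def_fx]]] := S'P _ (valP (f (Subring Sx))).
(* c is the residue of the image u/s of x, its value at 0. *)
have [c def_c] : exists c, c * s.[0] = u.[0] by exists (u.[0] / s.[0]); rewrite divfK.
exists c.
suff dvd_p : p %| 'X - c%:P.
  rewrite (eqp_root (irredp_XsubC c p _ dvd_p)) ?root_XsubC //.
  by rewrite neq_ltn irr_p orbT.
(* If p did not divide X - c, then x - c would be a unit of S, although its image (u - c s)/s
   vanishes at 0. Evaluating the cleared relation at 0 gives the contradiction. *)
apply: contraT => ndvd_p.
have Sv : (iota ('X - c%:P))^-1 \in S by rewrite (local_at_inv locS) ?polyXsubC_eq0.
have [a [b [b0 def_fv]]] := S'P _ (valP (f (Subring Sv))).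
have : val (f (Subring Sx - Subring (kS c)) * f (Subring Sv)) = 1.
  rewrite -rmorphM -[RHS]/(val (1 : subring_of S')) -(rmorph1 f); congr (val (f _)).
  apply: val_inj; rewrite /= -rmorphB divff // (frac_eq0 iotaK) polyXsubC_eq0 //.
rewrite rmorphB f_cst rmorphM rmorphB /= def_fx def_fv => eq1.
have : iota ((u - c%:P * s) * a) = iota (s * b).
  rewrite !(rmorphM, rmorphB).
  have := iota_neq0 _ s0; have := iota_neq0 _ b0 => bi si.
  have -> : iota s * iota b = iota s * iota b * 1 by rewrite mulr1.
  by rewrite -eq1; field; rewrite si bi.
move/(iotaK.1)/(congr1 (fun q : {poly k} => q.[0])).
rewrite !(hornerM, hornerD, hornerN) hornerC def_c subrr mul0r => /esym/eqP.
by rewrite mulf_eq0 (negPf s0) (negPf b0).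
Qed.
End Local.

(** * Application to k(x) *)

Definition ratfun_iota (k : fieldType) : {rmorphism {poly k} -> ratfun k} :=
  @FracField.tofrac {poly k}.

Lemma fraction_field_ratfun (k : fieldType) : fraction_field (ratfun_iota k).
Proof.
split=> [p q /eqP|z]; last exact: fracP.
by rewrite /ratfun_iota tofrac_eq => /eqP.
Qed.

(** A representation a/s of f/g with p not dividing s need not be reduced. From f s = a g, if p
    divided g it would divide f as well, against coprimality. *)
Lemma localization_local_at (k : fieldType) (p : {poly k}) (P : prime_idealr {poly k}) :
  irreducible_poly p -> (forall q, (q \in P) = (p %| q)) ->
  local_at (ratfun_iota k) p (localization P).
Proof.
move=> irr_p memP f g cop_fg g_neq0; apply/localizationP/idP; last first.
  by move=> ndvd_pg; exists f, g; rewrite memP.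
move=> [a [s []]]; rewrite memP => ndvd_ps eq_fg.
have {eq_fg} : f * s = a * g.
  apply: (fraction_field_ratfun k).1; rewrite !rmorphM; apply/eqP.
  rewrite -eqr_div ?(frac_eq0 (fraction_field_ratfun k)) //; first exact/eqP.
  by apply: contraNneq ndvd_ps => ->; apply: dvdp0.
move=> eq_fg; apply: contra ndvd_ps => dvd_pg.
have : p %| f * s by rewrite eq_fg dvdp_mull.
rewrite irredp_dvdM // => /orP[dvd_pf|//].
by case: (irredp_dvd_coprime irr_p cop_fg dvd_pf dvd_pg).
Qed.

(** Carrying [irr_p] as an argument allows the prime ideal structure to be declared as an
    instance. *)
Definition multiples (k : fieldType) (p : {poly k}) (irr_p : irreducible_poly p) :
  {pred {poly k}} := fun q => p %| q.

Section Multiples.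
Variables (k : fieldType) (p : {poly k}) (irr_p : irreducible_poly p).

Fact multiples_idealr : idealr_closed (multiples irr_p).
Proof.
split; rewrite -?topredE /= /multiples; first exact: dvdp0.
  by rewrite irredp_dvd1.
by move=> a q r pq pr; apply: dvdp_add => //; apply: dvdp_mull.
Qed.

Fact multiples_prime : prime_idealr_closed (multiples irr_p).
Proof. by move=> q r; rewrite -!topredE /= /multiples irredp_dvdM. Qed.

HB.instance Definition _ := isIdealr.Build {poly k} (multiples irr_p) multiples_idealr.
HB.instance Definition _ :=
  isPrimeIdealrClosed.Build {poly k} (multiples irr_p) multiples_prime.
End Multiples.

Lemma closed_field_of_roots (k : fieldType) :
  (forall p : {poly k}, irreducible_poly p -> exists c, root p c) ->
  GRing.closed_field_axiom k.
Proof.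
move=> rootP n P n_gt0.
(* The roots of [q] are the solutions of the equation in [GRing.closed_field_axiom]. *)
pose q : {poly k} := 'X^n - \poly_(i < n) P i.
have sq : size q = n.+1.
  by rewrite size_polyDl size_polyXn // size_polyN ltnS size_poly.
have [p irr_p dvd_pq] : exists2 p, irreducible_poly p & p %| q.
  by apply: irreducible_factor; rewrite sq.
have [c pc] := rootP p irr_p; exists c.
have /dvdpP[r def_q] := dvd_pq.
have : root q c by rewrite def_q rootM pc orbT.
by rewrite /root /q hornerD hornerN hornerXn horner_poly subr_eq0 => /eqP.
Qed.

Theorem proposition3p7 (k : fieldType) :
  (forall R : subringClosed (ratfun k),
     maximal_subring R -> contains_const R -> is_field (subring_of R) ->
     ring_isomorphic (subring_of R) (ratfun k))
  /\
  (GRing.closed_field_axiom k <->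
   forall (R : subringClosed (ratfun k)) (kR : contains_const R),
     maximal_subring R ->
     k_isomorphic (subring_const kR) (@ratfun_const k)
     \/ k_isomorphic (subring_const kR) (subring_const (@local_X_const k))).
Proof.
have iotaK := fraction_field_ratfun k.
have irrX : irreducible_poly ('X : {poly k}) by rewrite -['X]subr0; apply: irredp_XsubC.
have locX : local_at (ratfun_iota k) 'X (local_X k) by apply: localization_local_at.
split; [|split].
- move=> R maxR kR fieldR.
  have [f [bij_f _]] := maximal_field_k_isomorphic iotaK kR maxR fieldR.
  by exists f.
- move=> closed_k R kR maxR.
  have [fieldR|nfieldR] := pselect (is_field (subring_of R)).
    by left; apply: (maximal_field_k_isomorphic iotaK kR maxR fieldR).
  right.
  exact: (k_isomorphic_local iotaK kR (@local_X_const k) closed_k maxR nfieldR locX).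
move=> max_iso; apply: closed_field_of_roots => p irr_p.
pose R : subringClosed (ratfun k) := localization (multiples irr_p).
have locR : local_at (ratfun_iota k) p R by apply: localization_local_at.
have kR : contains_const R by move=> c; apply: localization_tofrac.
have [|[f [bij_f _]]|iso] := max_iso R kR.
- exact: (local_maximal iotaK irr_p locR).
- by case: (local_nonfield irr_p locR); apply: is_field_bijective bij_f.
- exact: (local_residue iotaK irr_p locR locX iso).
Qed.
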